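(* Let $G$ be a graph and $\theta$ a real number. A set $X\subseteq V(G)$ is a maximal (under inclusion) $\theta$-Tutte set in $G$ if and only if $X$ is a maximal (under inclusion) $\theta$-extreme set in $G$.
   Context: All graphs are finite and simple. For a graph $G$ on $n$ vertices, let $p(G,r)$ be the number of $r$-matchings of $G$ ($p(G,0)=1$); the matching polynomial is $\mu(G,x)=\sum_{r=0}^{\lfloor n/2\rfloor}(-1)^r p(G,r)x^{n-2r}$ (the graph with no vertices has $\mu=1$). For real $\theta$, $\mathrm{mult}(\theta,G)$ is the multiplicity of $\theta$ as a root of $\mu(G,x)$ (it is $0$ if $\theta$ is not a root). For $X\subseteq V(G)$, $G\setminus X$ is the graph obtained by deleting the vertices of $X$ and their incident edges; $G\setminus u$ means $G\setminus\{u\}$. A vertex $u$ is $\theta$-essential in $G$ if $\mathrm{mult}(\theta,G\setminus u)=\mathrm{mult}(\theta,G)-1$. A connected graph is $\theta$-critical if every one of its vertices is $\theta$-essential in it; $c_\theta(G)$ denotes the number of connected components of $G$ that are $\theta$-critical. A set $X\subseteq V(G)$ is a $\theta$-Tutte set if $c_\theta(G\setminus X)=\mathrm{mult}(\theta,G)+|X|$, and a $\theta$-extreme set if $\mathrm{mult}(\theta,G\setminus X)=\mathrm{mult}(\theta,G)+|X|$. *)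

(* Defs.v *)
From HB Require Import structures.
From mathcomp Require Import all_boot all_order all_algebra.
Set Implicit Arguments. Unset Strict Implicit. Unset Printing Implicit Defensive.
Import Order.TTheory GRing.Theory Num.Theory.
Local Open Scope ring_scope.

(* A simple graph is (T, e) with T : finType, e : rel T symmetric and
   irreflexive.  All notions below are for the induced subgraph G[S] on a
   vertex set S : {set T}; the graph G itself is G[setT], and
   G \ X is G[S :\: X]. *)
Section Graphs.
Variable T : finType.
Variable e : rel T.

Definition edges (S : {set T}) : {set {set T}} :=
  [set E : {set T} | (E \subset S) &&
     [exists u : T, exists v : T, (E == [set u; v]) && e u v]].

Definition is_matching (S : {set T}) (M : {set {set T}}) : bool :=
  (M \subset edges S) && trivIset M.

Definition nmatch (S : {set T}) (r : nat) : nat :=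
  #|[set M : {set {set T}} | is_matching S M && (#|M| == r)%N]|.

Definition match_poly (R : nzRingType) (S : {set T}) : {poly R} :=
  \sum_(r < (#|S|)./2.+1)
     ((-1) ^+ r * (nmatch S r)%:R) *: 'X^(#|S| - 2 * r)%N.

Definition mult (R : fieldType) (theta : R) (S : {set T}) : nat :=
  mup theta (match_poly R S).

Definition erel (S : {set T}) : rel T :=
  [rel x y | [&& x \in S, y \in S & e x y]].

Definition comp (S : {set T}) (x : T) : {set T} :=
  [set y in S | connect (erel S) x y].

Definition components (S : {set T}) : {set {set T}} :=
  [set comp S x | x in S].

Definition essential (R : fieldType) (theta : R) (S : {set T}) (u : T) : bool :=
  (mult theta (S :\ u)).+1 == mult theta S.

Definition critical (R : fieldType) (theta : R) (C : {set T}) : bool :=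
  (C \in components C) && [forall u in C, essential theta C u].

Definition ncrit (R : fieldType) (theta : R) (S : {set T}) : nat :=
  #|[set C in components S | critical theta C]|.

Definition tutte_set (R : fieldType) (theta : R) (S X : {set T}) : bool :=
  (X \subset S) && (ncrit theta (S :\: X) == mult theta S + #|X|)%N.

Definition extreme_set (R : fieldType) (theta : R) (S X : {set T}) : bool :=
  (X \subset S) && (mult theta (S :\: X) == mult theta S + #|X|)%N.

End Graphs.

(* Main.v *)
Require Import Defs.
From HB Require Import structures.
From mathcomp Require Import all_boot all_order all_algebra.
From mathcomp Require Import ring zify.
Set Implicit Arguments. Unset Strict Implicit. Unset Printing Implicit Defensive.
Import Order.TTheory GRing.Theory Num.Theory.
Local Open Scope ring_scope.

(* By interlacing, a Tutte set is extreme, so it suffices that a maximal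
   extreme set X is a Tutte set.  Maximality says that H = G \ X has no
   theta-positive vertex (one whose deletion raises the multiplicity), and one
   shows that then mult(theta, H) counts the theta-critical components of H.

   The engine is Godsil's identity: mu(G\u) mu(G\v) - mu(G) mu(G\uv) is the sum
   of mu(G\P)^2 over the paths P from u to v.  Since a sum of squares over an
   ordered field vanishes to even order at theta, comparing orders yields
   interlacing and the fact that a neighbour of an essential vertex is essential
   or positive; hence each component of H with positive multiplicity is critical.

   A critical graph has multiplicity m = 1 (Gallai's lemma): call u, v parallel
   if mult(G\uv) >= m - 1.  Adjacent vertices are parallel.  Parallelism is
   transitive, because Godsil's identity holds for arbitrary vertex weights, and
   the perturbation of one weight produces a leading coefficient that must be
   nonnegative although it is affine in a free parameter.  By connectedness all
   pairs are parallel, so G\u has no essential vertex, i.e. mult(G\u) = 0. *)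

Lemma setD1C (T : finType) (S : {set T}) (u v : T) : S :\ u :\ v = S :\ v :\ u.
Proof. by rewrite !setDDl setUC. Qed.

(** * The matching polynomial and its vertex-deletion recurrence *)

Section MatchingPolynomial.
Variables (T : finType) (e : rel T).
Hypotheses (e_sym : symmetric e) (e_irr : irreflexive e).
Implicit Types (S : {set T}) (M : {set {set T}}).

Lemma edgesP S (E : {set T}) :
  reflect (exists u v, [/\ E = [set u; v], e u v, u \in S & v \in S])
          (E \in edges e S).
Proof.
rewrite inE; apply: (iffP andP) => [[sES /existsP[u /existsP[v /andP[/eqP E_uv euv]]]]|].
  exists u, v; split=> //; apply: (subsetP sES); rewrite E_uv !inE eqxx ?orbT //.
case=> u [v [-> euv uS vS]]; split; first by rewrite subUset !sub1set uS.
by apply/existsP; exists u; apply/existsP; exists v; rewrite eqxx.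
Qed.

Lemma edge_neq u v : e u v -> u != v.
Proof. by apply: contraTneq => ->; rewrite e_irr. Qed.

Lemma card_edge S (E : {set T}) : E \in edges e S -> #|E| = 2%N.
Proof. by case/edgesP=> u [v [-> /edge_neq uv _ _]]; rewrite cards2 uv. Qed.

Lemma cover_edges S M : M \subset edges e S -> cover M \subset S.
Proof.
move=> sM; apply/bigcupsP => E /(subsetP sM); rewrite inE => /andP[-> _] //.
Qed.

Lemma card_matching S M : is_matching e S M -> (#|M|.*2 <= #|S|)%N.
Proof.
case/andP=> sM /eqP tM; rewrite (leq_trans _ (subset_leq_card (cover_edges sM))) //.
rewrite -tM (eq_bigr (fun=> 2%N)) => [|E /(subsetP sM) /card_edge //].
by rewrite sum_nat_const muln2.
Qed.

(** Indexing by matchings rather than by their size lets the recurrence come from bijections between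
    sets of matchings. *)
Lemma match_polyE (R : nzRingType) S :
  match_poly e R S =
  \sum_(M | is_matching e S M) (-1) ^+ #|M| *: 'X^(#|S| - #|M|.*2).
Proof.
pose r M : 'I_(#|S|)./2.+1 := inord #|M|.
rewrite (partition_big r xpredT) //=; apply: eq_bigr => i _.
have rE M : is_matching e S M -> (r M == i) = (#|M| == i)%N.
  move=> /card_matching mM; rewrite -val_eqE /= inordK // ltnS.
  by rewrite -(doubleK #|M|) half_leq.
rewrite (eq_bigl (fun M => M \in [set M | is_matching e S M && (#|M| == i)%N])).
  rewrite (eq_bigr (fun=> (-1) ^+ i *: 'X^(#|S| - i.*2))); last first.
    by move=> M; rewrite inE => /andP[_ /eqP->].
  by rewrite sumr_const scalerMnl /nmatch mulr_natr mul2n.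
by move=> M; rewrite inE; case mM: (is_matching e S M); rewrite //= rE.
Qed.

Lemma is_matchingD1 S M u :
  is_matching e (S :\ u) M = is_matching e S M && (u \notin cover M).
Proof.
apply/andP/andP => [[sM tM]|[/andP[sM tM] uM]]; split=> //.
- rewrite /is_matching tM andbT; apply: subset_trans sM _.
  apply/subsetP => E; rewrite !inE => /andP[sE ->]; rewrite andbT.
  exact: subset_trans sE (subsetDl _ _).
- by apply/negP => /(subsetP (cover_edges sM)); rewrite !inE eqxx.
apply/subsetP => E EM; have := subsetP sM _ EM; rewrite !inE => /andP[sE ->].
rewrite andbT subsetD1 sE /=; apply: contra uM => uE.
by apply/bigcupP; exists E.
Qed.

Lemma is_matchingU1 S M u v : u \in S -> v \in S -> e u v ->
  is_matching e S ([set u; v] |: M) && ([set u; v] \notin M)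
  = is_matching e (S :\ u :\ v) M.
Proof.
move=> uS vS euv; rewrite !is_matchingD1; apply/idP/idP.
  case/andP=> /andP[sM tM] nM; rewrite /is_matching.
  rewrite (subset_trans (subsetUr _ _) sM) (trivIsetS (subsetUr _ _) tM) /=.
  suff nc w : w \in [set u; v] -> w \notin cover M by rewrite !nc ?inE ?eqxx ?orbT.
  move=> wuv; apply: contra nM => /bigcupP[E EM wE].
  suff <- : E = [set u; v] by [].
  apply: contraTeq tM => nE; apply/negP => /trivIsetP/(_ E [set u; v]).
  rewrite !inE EM orbT eqxx nE => /(_ isT isT isT)/pred0P/(_ w) /=.
  by rewrite wE wuv.
case/andP=> /andP[/andP[sM tM] nu nv].
have dM : {in M, forall B : {set T}, [disjoint [set u; v] & B]}.
  move=> B BM; rewrite disjoints_subset subUset !sub1set !inE.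
  by apply/andP; split; [apply: contra nu | apply: contra nv] => ?;
    apply/bigcupP; exists B.
have [|tU ->] := trivIsetU1 dM tM.
  by apply/negP => /(subsetP sM)/card_edge; rewrite cards0.
rewrite /is_matching tU andbT andbT subUset sM andbT sub1set.
by apply/edgesP; exists u, v.
Qed.

(** Matchings are split by whether they cover [u], and those that do by the partner [v] of [u];
    removing the edge [u v] leaves a matching of [S :\ u :\ v]. *)
Lemma match_poly_rec (R : comNzRingType) S u : u \in S ->
  match_poly e R S = 'X * match_poly e R (S :\ u)
     - \sum_(v in S | e u v) match_poly e R (S :\ u :\ v).
Proof.
move=> uS; have cS : #|S| = #|S :\ u|.+1 by rewrite (cardsD1 u S) uS.
rewrite match_polyE (bigID (fun M => u \notin cover M)) /=; congr (_ + _).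
  rewrite (eq_bigl (is_matching e (S :\ u))) => [|M]; last by rewrite is_matchingD1.
  rewrite match_polyE mulr_sumr; apply: eq_bigr => M mM.
  by rewrite -scalerAr -exprS cS subSn // card_matching.
(* The partner of [u] in [M]; the default [u] is never taken when [M] covers [u]. *)
pose p M := odflt u [pick v | ([set u; v] \in M) && e u v].
rewrite (partition_big p (fun v => (v \in S) && e u v)) /=; last first.
  move=> M /andP[/andP[sM tM]]; rewrite negbK => /bigcupP[E EM uE].
  rewrite /p; case: pickP => [v /andP[vM euv] /=|].
    rewrite euv andbT; apply: (subsetP (cover_edges sM)); apply/bigcupP.
    by exists [set u; v]; rewrite // !inE eqxx orbT.
  have /edgesP[x [y [EE exy _ _]]] := subsetP sM _ EM.
  move: uE; rewrite EE !inE => /orP[] /eqP uE.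
    by move/(_ y); rewrite uE -EE EM exy.
  by move/(_ x); rewrite uE setUC -EE EM e_sym exy.
rewrite -sumrN; apply: eq_bigr => v /andP[vS euv].
have uv := edge_neq euv.
rewrite (eq_bigl (fun M => is_matching e S M && ([set u; v] \in M))); last first.
  move=> M; case mM: (is_matching e S M); rewrite //= negbK.
  have /andP[sM /trivIsetP tM] := mM.
  apply/andP/idP => [[uM]|vM].
    rewrite /p; case: pickP => [w /andP[wM _] /eqP <- //|/= _ /eqP uv'].
    by rewrite uv' eqxx in uv.
  split; first by apply/bigcupP; exists [set u; v]; rewrite ?inE ?eqxx.
  rewrite /p; case: pickP => [w /andP[wM euw] /=|/(_ v)]; last by rewrite vM euv.
  apply: contraTT isT => wv.
  have /(tM _ _ wM vM) : [set u; w] != [set u; v].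
    apply/eqP => /setP/(_ w); rewrite !inE eqxx orbT (negPf wv) orbF.
    by move/esym/eqP => wu; rewrite wu e_irr in euw.
  by move/pred0P/(_ u); rewrite /= !inE eqxx.
rewrite (reindex_onto (fun M => [set u; v] |: M) (fun M => M :\ [set u; v])) /=;
  last by move=> M /andP[_ vM]; rewrite setD1K.
rewrite match_polyE -sumrN; apply: eq_big => M.
  rewrite -(is_matchingU1 _ uS vS euv) -andbA; congr (_ && _).
  rewrite setU11 /=; apply/eqP/idP => [<-|]; first by rewrite !inE eqxx.
  exact: setU1K.
case/andP=> _ /eqP nM; have vM : [set u; v] \notin M by rewrite -nM !inE eqxx.
rewrite cardsU1 vM add1n exprS mulN1r scaleNr; congr (- (_ *: 'X^_)).
rewrite cS (cardsD1 v (S :\ u)) !inE eq_sym uv vS /=; lia.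
Qed.

Lemma match_poly0 (R : nzRingType) : match_poly e R set0 = 1.
Proof.
rewrite match_polyE (big_pred1 set0) => [|M].
  by rewrite !cards0 expr0 scale1r expr0.
apply/idP/eqP => [/card_matching|->].
  by rewrite cards0 leqn0 double_eq0 cards_eq0 => /eqP.
by rewrite /is_matching sub0set /trivIset /cover !big_set0 cards0.
Qed.
End MatchingPolynomial.

(** * Sums of squares and their order of vanishing at a point *)

Definition sos (A : pzSemiRingType) (p : A) : Prop :=
  exists s : seq A, p = \sum_(q <- s) q ^+ 2.

Section SumsOfSquares.
Variable A : pzSemiRingType.

Lemma sos0 : sos (0 : A).
Proof. by exists [::]; rewrite big_nil. Qed.

Lemma sosD (p q : A) : sos p -> sos q -> sos (p + q).
Proof. by move=> [s ->] [s' ->]; exists (s ++ s'); rewrite big_cat. Qed.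

Lemma sos_sqr (p : A) : sos (p ^+ 2).
Proof. by exists [:: p]; rewrite big_seq1. Qed.

Lemma sos_sum (I : finType) (P : pred I) (f : I -> A) :
  (forall i, P i -> sos (f i)) -> sos (\sum_(i | P i) f i).
Proof. by apply: big_ind; [exact: sos0 | exact: sosD]. Qed.

End SumsOfSquares.

Section PolySumsOfSquares.
Variables (R : realFieldType) (a : R).
Implicit Types (p q : {poly R}) (s : seq {poly R}).
Local Notation t := ('X - a%:P).

(** Over an ordered field a sum of squares vanishes at [a] only if every term does, so [t] can be
    divided out of all the [q] at once. Orders are thus even, and the odd exponent [j.*2.-1] already
    yields [j.*2]. *)
Lemma sum_sqr_dvdXsubC s j : t ^+ j.*2.-1 %| \sum_(q <- s) q ^+ 2 ->
  exists2 s', s = [seq r * t ^+ j | r <- s']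
            & \sum_(q <- s) q ^+ 2 = (\sum_(r <- s') r ^+ 2) * t ^+ j.*2.
Proof.
have tN0 k : t ^+ k != 0 by rewrite expf_neq0 ?polyXsubC_eq0.
elim: j => [|j IHj] dvd_s.
  exists s; last by rewrite expr0 mulr1.
  by rewrite -[LHS]map_id; apply: eq_map => r; rewrite expr0 mulr1.
have [|s' def_s sum_s] := IHj; first by apply: dvdp_trans dvd_s; apply: dvdp_exp2l; lia.
have r0 : {in s', forall r, t %| r}.
  move: dvd_s; rewrite sum_s doubleS /= exprS dvdp_mul2r ?tN0 // dvdp_XsubCl.
  rewrite rootE horner_sum psumr_eq0 => [/allP r0 r /r0|r _]; last first.
    by rewrite horner_exp sqr_ge0.
  by rewrite /= horner_exp sqrf_eq0 dvdp_XsubCl.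
exists [seq r %/ t | r <- s'].
  rewrite def_s -map_comp; apply/eq_in_map => r /r0 tr /=.
  by rewrite exprS mulrA divpK.
rewrite sum_s big_map (_ : j.+1.*2 = 2 + j.*2)%N // exprD mulrA; congr (_ * _).
rewrite mulr_suml; apply: eq_big_seq => r /r0 tr.
by rewrite -exprMn divpK.
Qed.

Lemma sos_dvdXsubC_even p j : sos p -> t ^+ j.*2.-1 %| p -> t ^+ j.*2 %| p.
Proof. by case=> s -> /sum_sqr_dvdXsubC[s' _ ->]; rewrite dvdp_mull. Qed.

Lemma sqrD_sos_dvdXsubC q p j : sos p ->
  t ^+ j.*2.-1 %| q ^+ 2 + p -> t ^+ j %| q.
Proof.
case=> s ->; have -> : q ^+ 2 + \sum_(r <- s) r ^+ 2 = \sum_(r <- q :: s) r ^+ 2.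
  by rewrite big_cons.
by case/sum_sqr_dvdXsubC=> -[//|r s'] [-> _] _; rewrite dvdp_mull.
Qed.

(** The cofactor [r] is itself a sum of squares. *)
Lemma sos_cofactor_ge0 p r j : sos p -> p = r * t ^+ j.*2 -> 0 <= r.[a].
Proof.
case=> s -> def_p; have [|s' _] := @sum_sqr_dvdXsubC s j.
  by rewrite def_p dvdp_mull // dvdp_exp2l // leq_pred.
rewrite def_p => /mulIf -> //; last by rewrite expf_neq0 ?polyXsubC_eq0.
by rewrite horner_sum sumr_ge0 // => q _; rewrite horner_exp sqr_ge0.
Qed.

Lemma deriv_dvdXsubC p k : t ^+ k %| p -> t ^+ k.-1 %| p^`().
Proof.
case/dvdpP=> r ->; rewrite derivM deriv_exp derivXsubC mul1r dvdp_add //.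
  by rewrite dvdp_mull // dvdp_exp2l // leq_pred.
by rewrite mulrnAr -mulr_natr dvdp_mulr // dvdp_mull.
Qed.
End PolySumsOfSquares.

(** * Godsil's identity for weighted vertex recurrences *)

Section VertexRecurrence.
Variables (T : finType) (e : rel T).
Hypothesis e_irr : irreflexive e.
Implicit Types (S : {set T}) (u v z : T).

(** The recurrence of a vertex-weighted matching polynomial, with [w u] in place of ['X]; kept
    abstract so that Godsil's identity also covers perturbed weights. *)
Definition vertex_rec (A : comNzRingType) (w : T -> A) (F : {set T} -> A) : Prop :=
  forall S u, u \in S ->
    F S = w u * F (S :\ u) - \sum_(v in S | e u v) F (S :\ u :\ v).

Variables (A : comNzRingType) (w : T -> A) (F : {set T} -> A).
Hypothesis F_rec : vertex_rec w F.

(* Unfolding the recurrence, the sum of squares below runs over the paths from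
   [u] to [v]; the edge [u v], when present, contributes the isolated square. *)
Lemma godsil_sos S u v : u \in S -> v \in S -> u != v ->
  sos (F (S :\ u) * F (S :\ v) - F S * F (S :\ u :\ v)
       - F (S :\ u :\ v) ^+ 2 *+ e u v).
Proof.
have [n] := ubnP #|S|; elim: n S u v => // n IHn S u v leSn uS vS uv.
have splitS : \sum_(z in S | e u z) F (S :\ u :\ z) =
    F (S :\ u :\ v) *+ e u v + \sum_(z in S :\ v | e u z) F (S :\ u :\ z).
  rewrite (bigID (pred1 v)) /=; congr (_ + _); last first.
    by apply: eq_bigl => z; rewrite !inE andbC andbA.
  rewrite (eq_bigl (fun z => e u v && (z == v))) => [|z].
    by case: (e u v); rewrite ?big_pred1_eq // big_pred0.
  by case: eqP => [->|_]; rewrite ?andbF // vS !andbT.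
rewrite (F_rec uS) (@F_rec (S :\ v) u) ?inE ?uv // splitS (setD1C S v u).
set a := F (S :\ u); set b := F (S :\ u :\ v).
(* The summand at [z] is Godsil's difference for [S :\ u] and the pair [z], [v], so induction
   applies. *)
suff -> : a * (w u * b - \sum_(z in S :\ v | e u z) F (S :\ u :\ v :\ z)) -
    (w u * a - (b *+ e u v + \sum_(z in S :\ v | e u z) F (S :\ u :\ z))) * b
    - b ^+ 2 *+ e u v = \sum_(z in S :\ v | e u z)
       (F (S :\ u :\ z) * b - a * F (S :\ u :\ v :\ z)).
  apply: sos_sum => z; rewrite !inE => /andP[/andP[zv zS] euz].
  have zu : z != u by apply: contraTneq euz => ->; rewrite e_irr.
  have := IHn (S :\ u) z v; rewrite !inE zu zS vS eq_sym uv zv (setD1C (S :\ u) z v).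
  case=> // [|s defs]; first by have := cardsD1 u S; rewrite uS; lia.
  rewrite -[X in sos X](subrK (F (S :\ u :\ v :\ z) ^+ 2 *+ e z v)).
  apply: sosD; first by exists s.
  by case: (e z v); [exact: sos_sqr | exact: sos0].
rewrite sumrB -mulr_suml -mulr_sumr.
by case: (e u v); rewrite ?mulr1n ?mulr0n; ring.
Qed.

Corollary godsil_sosW S u v : u \in S -> v \in S -> u != v ->
  sos (F (S :\ u) * F (S :\ v) - F S * F (S :\ u :\ v)).
Proof.
move=> uS vS uv; have sosW := godsil_sos uS vS uv.
rewrite -[X in sos X](subrK (F (S :\ u :\ v) ^+ 2 *+ e u v)).
by apply: sosD => //; case: (e u v); [exact: sos_sqr | exact: sos0].
Qed.

(** A solution of the recurrence is affine in each single weight; this is the effect of adding [s]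
    to the weight of [z]. *)
Definition perturb (s : A) z S : A :=
  F S + (if z \in S then s * F (S :\ z) else 0).

Lemma perturb_rec s z :
  vertex_rec (fun u => w u + (if u == z then s else 0)) (perturb s z).
Proof.
move=> S u uS; rewrite /perturb (F_rec uS) big_split /=.
have [<-|uz] := eqVneq u z.
  rewrite uS !inE eqxx /= addr0 [X in _ - (_ + X)]big1 => [|v _]; first by ring.
  by rewrite !inE eqxx andbF.
rewrite !inE (eq_sym z u) uz /= !addr0.
case: ifPn => zS; last first.
  by rewrite [X in _ - (_ + X)]big1 ?addr0 // => v _; rewrite !inE (negPf zS) !andbF.
rewrite (@F_rec (S :\ z) u) ?inE ?uz //.
have -> : \sum_(v in S | e u v) (if z \in S :\ u :\ v then
      s * F (S :\ u :\ v :\ z) else 0) =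
    s * \sum_(v in S :\ z | e u v) F (S :\ z :\ u :\ v).
  rewrite mulr_sumr [RHS](eq_bigl (fun v => ((v \in S) && e u v) && (v != z))).
    rewrite [RHS]big_mkcondr /=; apply: eq_bigr => v _.
    rewrite !inE zS (eq_sym z u) uz !andbT (eq_sym z v).
    by rewrite (setD1C _ v z) (setD1C _ u z).
  by move=> v; rewrite !inE -andbA andbC.
by rewrite (setD1C S z u); ring.
Qed.

End VertexRecurrence.

(** * Interlacing, essential vertices and parallelism *)

Section Multiplicity.
Variables (T : finType) (e : rel T).
Hypotheses (e_sym : symmetric e) (e_irr : irreflexive e).
Variables (R : realFieldType) (theta : R).
Implicit Types (S : {set T}) (u v z : T).
Local Notation t := ('X - theta%:P).
Local Notation mu := (match_poly e R).
Local Notation mult := (mult e theta).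
Local Notation mu_rec := (match_poly_rec e_sym e_irr R).

Lemma match_poly_vertex_rec : vertex_rec e (fun=> 'X) mu.
Proof. by move=> S u; exact: mu_rec. Qed.

Lemma match_poly_coef_size S : (size (mu S) <= #|S|.+1)%N /\ (mu S)`_#|S| = 1.
Proof.
have [n] := ubnP #|S|; elim: n S => // n IHn S leSn.
have [->|[u uS]] := set_0Vmem S.
  by rewrite match_poly0 // size_poly1 cards0 coef1.
have cS : #|S| = #|S :\ u|.+1 by rewrite (cardsD1 u S) uS.
have [|sz1 c1] := IHn (S :\ u); first by lia.
have sz2 : (size (\sum_(v in S | e u v) mu (S :\ u :\ v))%R
            <= #|S :\ u|.+1)%N.
  apply: (big_ind (fun p : {poly R} => (size p <= #|S :\ u|.+1)%N)).
  - by rewrite size_poly0.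
  - by move=> p q sp sq; rewrite (leq_trans (size_polyD _ _)) // geq_max sp.
  move=> v _; have leq_card : (#|S :\ u :\ v| <= #|S :\ u|)%N.
    by rewrite subset_leq_card ?subD1set.
  have [|sz _] := IHn (S :\ u :\ v); first by lia.
  by rewrite (leq_trans sz).
rewrite (mu_rec uS); split.
  rewrite (leq_trans (size_polyD _ _)) // size_polyN geq_max cS.
  rewrite (leq_trans sz2) // andbT mulrC (leq_trans (size_polyMleq _ _)) //.
  by rewrite size_polyX addn2.
by rewrite coefB coefXM cS /= c1 (nth_default _ sz2) subr0.
Qed.

Lemma match_poly_neq0 S : mu S != 0.
Proof.
have [_] := match_poly_coef_size S; apply: contra_eq_neq => ->.
by rewrite coef0 eq_sym oner_neq0.
Qed.

Lemma mult_geq S k : (k <= mult S)%N = (t ^+ k %| mu S).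
Proof. by rewrite mup_geq ?match_poly_neq0. Qed.

Lemma mult_factor S : exists2 p, mu S = p * t ^+ mult S & p.[theta] != 0.
Proof.
have /dvdpP[p def_p] : t ^+ mult S %| mu S by rewrite -mult_geq.
exists p => //; have : ~~ (t ^+ (mult S).+1 %| mu S) by rewrite -mult_geq ltnn.
apply: contra => /eqP/rootP; rewrite -dvdp_XsubCl => tp.
by rewrite def_p exprS dvdp_mul.
Qed.

Lemma match_polyM_dvd S1 S2 k : (k <= mult S1 + mult S2)%N ->
  t ^+ k %| mu S1 * mu S2.
Proof.
by move=> lek; rewrite (dvdp_trans (dvdp_exp2l _ lek)) // exprD dvdp_mul -?mult_geq.
Qed.

Lemma match_poly_deriv S : (mu S)^`() = \sum_(u in S) mu (S :\ u).
Proof.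
have [n] := ubnP #|S|; elim: n S => // n IHn S leSn.
have [->|[u uS]] := set_0Vmem S; first by rewrite match_poly0 // derivC big_set0.
have cS : #|S| = #|S :\ u|.+1 by rewrite (cardsD1 u S) uS.
rewrite (big_setD1 u) //= (mu_rec uS) derivB derivM derivX mul1r -addrA.
congr (_ + _); rewrite (IHn (S :\ u)); last lia.
rewrite [RHS](eq_bigr (fun z => 'X * mu (S :\ u :\ z)
           - \sum_(v in S :\ z | e u v) mu (S :\ u :\ v :\ z))).
  rewrite sumrB -[in RHS]mulr_sumr; congr (_ - _); rewrite raddf_sum /=.
  under eq_bigr => v _.
    rewrite IHn; last by have := subset_leq_card (subD1set (S :\ u) v); lia.
    over.
  rewrite (exchange_big_dep (fun z => z \in S :\ u)) /=; last first.
    by move=> v z _; rewrite !inE => /and3P[_ -> ->].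
  apply: eq_bigr => z zSu; apply: eq_bigl => v.
  move: zSu; rewrite !inE => /andP[-> ->] /=; rewrite andbT (eq_sym z v).
  by rewrite andbC andbA.
move=> z; rewrite !inE => /andP[zu zS].
rewrite (@match_poly_rec _ _ e_sym e_irr _ (S :\ z) u) ?inE 1?eq_sym ?zu //.
rewrite (setD1C S z u); congr (_ - _); apply: eq_bigr => v _.
by rewrite (setD1C _ z v).
Qed.

(** Summing Godsil's identity over all [v] other than [u] gives the Wronskian of [mu (S :\ u)] and
    [mu S] as [mu (S :\ u) ^+ 2] plus a sum of squares. If [m >= k + 2], it vanishes to order at
    least [2k + 1], which forces order [k + 1] on [mu (S :\ u)]. *)
Lemma mult_leD1 S u : u \in S -> (mult S <= (mult (S :\ u)).+1)%N.
Proof.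
move=> uS; rewrite leqNgt; apply/negP => lt2.
suff : ((mult (S :\ u)).+1 <= mult (S :\ u))%N by rewrite ltnn.
set m := mult S in lt2 *; set k := mult (S :\ u) in lt2 *.
rewrite mult_geq.
have sosW : sos (\sum_(v in S :\ u)
     (mu (S :\ u) * mu (S :\ v) - mu S * mu (S :\ u :\ v))).
  apply: sos_sum => v; rewrite !inE eq_sym => /andP[uv vS].
  exact: (godsil_sosW e_irr match_poly_vertex_rec).
apply: (sqrD_sos_dvdXsubC sosW).
have -> : mu (S :\ u) ^+ 2 + \sum_(v in S :\ u)
     (mu (S :\ u) * mu (S :\ v) - mu S * mu (S :\ u :\ v)) =
   mu (S :\ u) * (mu S)^`() - mu S * (mu (S :\ u))^`().
  by rewrite !match_poly_deriv (big_setD1 u uS) /= sumrB -!mulr_sumr; ring.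
have dS : t ^+ m %| mu S by rewrite -mult_geq.
have dSu : t ^+ k %| mu (S :\ u) by rewrite -mult_geq.
apply: dvdp_sub.
  apply: (@dvdp_trans _ (t ^+ (k + m.-1))).
    by apply: dvdp_exp2l; lia.
  by rewrite exprD dvdp_mul // deriv_dvdXsubC.
apply: (@dvdp_trans _ (t ^+ (m + k.-1))).
  by apply: dvdp_exp2l; lia.
by rewrite exprD dvdp_mul // deriv_dvdXsubC.
Qed.

(** Every term of the recurrence at [u] has order at least [mult (S :\ u) - 1], by the other half of
    interlacing. *)
Lemma multD1_le S u : u \in S -> (mult (S :\ u) <= (mult S).+1)%N.
Proof.
move=> uS; case k0: (mult (S :\ u)) => [//|k]; rewrite ltnS mult_geq.
rewrite (mu_rec uS) dvdp_sub //.
  by rewrite dvdp_mull // -mult_geq k0.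
apply: (big_ind (fun p : {poly R} => t ^+ k %| p)).
- exact: dvdp0.
- by move=> p q; apply: dvdp_add.
move=> v /andP[vS euv]; rewrite -mult_geq -ltnS -k0 mult_leD1 // !inE vS andbT.
by rewrite eq_sym (edge_neq e_irr).
Qed.

(** Otherwise the derivative, being the sum of the [mu (S :\ u)], would vanish to order [mult S],
    whereas differentiation lowers a positive order by exactly one. *)
Lemma essential_exists S : (0 < mult S)%N -> exists2 u, u \in S & essential e theta S u.
Proof.
move=> m_gt0; apply/exists_inP; apply: contraTT m_gt0.
rewrite negb_exists_in -leqNgt leqn0 => /forall_inP ness.
have [p def_p p0] := mult_factor S.
case m0: (mult S) => [//|m]; have [] := negP p0.
have : t ^+ m.+1 %| (mu S)^`().
  rewrite match_poly_deriv; apply: (big_ind (fun p : {poly R} => t ^+ m.+1 %| p)).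
  - exact: dvdp0.
  - by move=> q r; apply: dvdp_add.
  move=> u uS; rewrite -mult_geq -m0; have := mult_leD1 uS.
  by have := ness u uS; rewrite /essential; lia.
rewrite def_p m0 derivM deriv_exp derivXsubC mul1r /= dvdp_addr; last first.
  by rewrite dvdp_mull.
rewrite exprS -mulr_natl mulrA dvdp_mul2r ?expf_neq0 ?polyXsubC_eq0 //.
rewrite dvdp_XsubCl rootM => /orP[/rootP/eqP //|].
by rewrite rootE -polyC_natr hornerC pnatr_eq0.
Qed.

(** If [v] were neutral, [mu (S :\ u) * mu (S :\ v)] would have the odd order [2m - 1]. The edge
    square forces order [m] on [mu (S :\ u :\ v)], so the other product has order at least [2m], and
    Godsil's difference would have odd order. *)
Lemma essential_neighbor S u v : u \in S -> v \in S -> e u v ->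
  essential e theta S u -> mult (S :\ v) != (mult S).+1 -> essential e theta S v.
Proof.
move=> uS vS euv /eqP essu npos; rewrite /essential; set m := mult S in essu npos *.
have := mult_leD1 vS; have := multD1_le vS; rewrite -/m => le1 le2.
case: eqP => // ness; have mv : mult (S :\ v) = m by lia.
have uv := edge_neq e_irr euv.
have uvS : (m <= (mult (S :\ u :\ v)).+1)%N.
  by rewrite setD1C -mv mult_leD1 // !inE uv.
have := godsil_sos e_irr match_poly_vertex_rec uS vS uv.
rewrite euv mulr1n => sosW.
set W := mu (S :\ u) * mu (S :\ v) - mu S * mu (S :\ u :\ v) in sosW.
have dW : t ^+ m.*2.-1 %| W.
  by apply: dvdp_sub; apply: match_polyM_dvd; lia.
have duv : t ^+ m %| mu (S :\ u :\ v).
  by apply: (sqrD_sos_dvdXsubC sosW); rewrite subrKC.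
rewrite -mult_geq in duv.
have : t ^+ m.*2 %| W.
  apply: sos_dvdXsubC_even => //.
  exact: (godsil_sosW e_irr match_poly_vertex_rec).
rewrite dvdp_subl; last by apply: match_polyM_dvd; lia.
rewrite -mup_geq ?mulf_neq0 ?match_poly_neq0 // mupM ?match_poly_neq0 //.
rewrite -/(mult _) -/(mult _) mv; lia.
Qed.

(** Both products in Godsil's difference have order at least [2(m - 1)], and the edge makes
    [mu (S :\ u :\ v) ^+ 2] one of the squares. *)
Lemma essential_adjacent S u v : u \in S -> v \in S -> e u v ->
  essential e theta S u -> essential e theta S v ->
  (mult S <= (mult (S :\ u :\ v)).+1)%N.
Proof.
move=> uS vS euv /eqP essu /eqP essv; set m := mult S in essu essv *.
have uv := edge_neq e_irr euv.
have uvS : (mult (S :\ u) <= (mult (S :\ u :\ v)).+1)%N.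
  by rewrite mult_leD1 // !inE eq_sym uv.
have := godsil_sos e_irr match_poly_vertex_rec uS vS uv.
rewrite euv mulr1n => sosW; rewrite -essu ltnS mult_geq.
apply: (sqrD_sos_dvdXsubC sosW); rewrite subrKC.
by apply: dvdp_sub; apply: match_polyM_dvd; lia.
Qed.

(* Shifting the weight of [z] by [sigma * ('X - theta)] keeps all orders of
   vanishing, but the leading coefficient of Godsil's sum of squares becomes
   affine in [sigma], with slope nonzero unless the conclusion holds. *)
Lemma essential_parallel_trans S u v z : u \in S -> v \in S -> z \in S ->
  u != v -> v != z -> u != z ->
  essential e theta S u -> essential e theta S v -> essential e theta S z ->
  (mult S <= (mult (S :\ u :\ v)).+1)%N -> (mult S <= (mult (S :\ v :\ z)).+1)%N ->
  (mult S <= (mult (S :\ u :\ z)).+1)%N.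
Proof.
move=> uS vS zS uv vz uz /eqP essu /eqP essv /eqP essz muv mvz.
rewrite leqNgt; apply/negP => muz.
have := @mult_leD1 (S :\ u) z; rewrite !inE (eq_sym z u) uz => /(_ zS) muz'.
have := @mult_leD1 (S :\ u :\ v) z; rewrite !inE (eq_sym z u) (eq_sym z v) uz vz.
move=> /(_ zS) muvz.
(* The negated conclusion forces [mult S >= 2]; from here on [m] stands for [mult S - 2]. *)
case m0: (mult S) essu essv essz muv mvz muz => [|[|m]] //; try lia.
move=> essu essv essz muv mvz muz.
have [A defA A0] := mult_factor (S :\ u).
have [B defB B0] := mult_factor (S :\ v).
have [D defD D0] := mult_factor (S :\ u :\ z).
have fac S' k : (k <= mult S')%N -> exists p, mu S' = p * t ^+ k.
  by rewrite mult_geq => /dvdpP.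
have [E defE] := fac (S :\ v :\ z) m.+1 ltac:(lia).
have [G defG] := fac S m.+2 ltac:(lia).
have [H defH] := fac (S :\ z) m.+1 ltac:(lia).
have [I defI] := fac (S :\ u :\ v) m.+1 ltac:(lia).
have [J defJ] := fac (S :\ u :\ v :\ z) m ltac:(lia).
(* Chosen so that [A + sigma D] takes the value [- B^-1] at [theta], which makes the cofactor [r]
   below equal to [-1] there. *)
pose sigma := (- B.[theta]^-1 - A.[theta]) / D.[theta].
have := godsil_sosW e_irr
  (perturb_rec match_poly_vertex_rec (sigma%:P * t) z) uS vS uv.
have [mu_u mu_v mu_uz] : [/\ mult (S :\ u) = m.+1, mult (S :\ v) = m.+1
    & mult (S :\ u :\ z) = m] by split; lia.
rewrite /perturb !inE zS (eq_sym z u) (eq_sym z v) uz vz /=.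
rewrite defA defB defD defE defG defH defI defJ mu_u mu_v mu_uz => sosW.
pose r := (A + sigma%:P * D) * (B + sigma%:P * t * E)
          - t * (G + sigma%:P * H) * (I + sigma%:P * J).
have : 0 <= r.[theta].
  apply: (sos_cofactor_ge0 (j := m.+1) sosW).
  by rewrite /r -addnn exprD !exprS; ring.
rewrite /r !hornerE subrr !(mul0r, mulr0) subr0 addr0 /sigma divfK //.
by rewrite addrC subrK mulNr mulVf // oppr_ge0 ler10.
Qed.
End Multiplicity.

(** * Connected components *)

Section Components.
Variables (T : finType) (e : rel T).
Hypothesis e_sym : symmetric e.
Implicit Types (S C : {set T}) (u v x y : T).

Lemma erel_connect_sym S : connect_sym (erel e S).
Proof.
apply: sym_connect_sym => x y; rewrite /erel /= e_sym.
by case: (x \in S); case: (y \in S).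
Qed.

Lemma components_partition S : partition (components e S) S.
Proof.
apply: equivalence_partitionP => x y z _ _ _; split; first exact: connect0.
by move/(same_connect (@erel_connect_sym S))->.
Qed.

Lemma component_sub S C : C \in components e S -> C \subset S.
Proof. exact: partitionS (components_partition S). Qed.

Lemma component_closed S C x y :
  C \in components e S -> x \in C -> y \in S -> e x y -> y \in C.
Proof.
case/imsetP=> x0 _ ->; rewrite !inE => /andP[xS x0x] yS exy; rewrite yS.
by apply: connect_trans x0x (connect1 _); rewrite /erel /= xS yS.
Qed.

(** Propagation along a path from [x], which never leaves [C] because components are closed under
    adjacency. *)
Lemma component_ind S C (Q : pred T) x : C \in components e S -> x \in C -> Q x ->
  {in C &, forall y z, Q y -> e y z -> Q z} -> {in C, forall y, Q y}.
Proof.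
move=> CS xC Qx stepQ y yC.
have /connectP[p] : connect (erel e S) x y.
  have [x0 _ defC] := imsetP CS; move: xC yC; rewrite defC !inE.
  move=> /andP[_ x0x] /andP[_ x0y].
  by rewrite (connect_trans _ x0y) // erel_connect_sym.
elim: p x xC Qx => [|z p IHp] x xC Qx /= => [_ -> //|].
case/andP=> /and3P[xS zS exz] pth def_y.
have zC := component_closed CS xC zS exz.
exact: IHp zC (stepQ _ _ xC zC Qx exz) pth def_y.
Qed.

Lemma component_self S C : C \in components e S -> C \in components e C.
Proof.
move=> CS; have : C != set0.
  by apply: contraTneq CS => ->; have /and3P[] := components_partition S.
case/set0Pn=> x xC; apply/imsetP; exists x => //; apply/setP => y; rewrite inE.
apply/esym/andb_idr; move: y.
apply: (component_ind CS xC); first exact: connect0.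
by move=> y z yC zC xy eyz; apply: connect_trans xy (connect1 _); rewrite /erel /= yC zC.
Qed.

End Components.

(** * Additivity over components and Gallai's lemma *)

Section Structure.
Variables (T : finType) (e : rel T).
Hypotheses (e_sym : symmetric e) (e_irr : irreflexive e).
Variables (R : realFieldType) (theta : R).
Implicit Types (S C X : {set T}) (u v x y : T).
Local Notation mu := (match_poly e R).
Local Notation mult := (mult e theta).

(** Induction on [S1]: the recurrence at a vertex of [S1] only involves neighbours in [S1]. *)
Lemma match_polyU S1 S2 : [disjoint S1 & S2] ->
  {in S1 & S2, forall x y, ~~ e x y} -> mu (S1 :|: S2) = mu S1 * mu S2.
Proof.
have [n] := ubnP #|S1|; elim: n S1 => // n IHn S1 leSn dS ne.
have [->|[u uS]] := set_0Vmem S1; first by rewrite set0U match_poly0 // mul1r.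
have cS := cardsD1 u S1; rewrite uS in cS.
have IH S' : S' \subset S1 :\ u -> mu (S' :|: S2) = mu S' * mu S2.
  move=> sS'; have sS1 := subset_trans sS' (subD1set _ _).
  apply: IHn; first by have := subset_leq_card sS'; lia.
  - exact: disjointWl sS1 dS.
  by move=> x y /(subsetP sS1); apply: ne.
have D1U S' v : v \in S1 -> (S' :|: S2) :\ v = S' :\ v :|: S2.
  move=> vS; rewrite setDUl; congr (_ :|: _); apply/setDidPl.
  by rewrite disjoint_sym disjoints1 (disjointFr dS).
rewrite (match_poly_rec e_sym e_irr R uS) (@match_poly_rec _ _ e_sym e_irr R (S1 :|: S2) u);
  last by rewrite inE uS.
rewrite D1U // IH // mulrBl mulrA; congr (_ - _); rewrite mulr_suml.
rewrite (eq_bigl (fun v => (v \in S1) && e u v)) => [|v]; last first.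
  rewrite inE; case vS1: (v \in S1) => //=; apply/andP => -[vS2 euv].
  by have /negP := ne u v uS vS2.
by apply: eq_bigr => v /andP[vS1 _]; rewrite D1U // IH // subD1set.
Qed.

Lemma multU S1 S2 : [disjoint S1 & S2] ->
  {in S1 & S2, forall x y, ~~ e x y} -> mult (S1 :|: S2) = (mult S1 + mult S2)%N.
Proof.
by move=> dS ne; rewrite /Defs.mult match_polyU // mupM // match_poly_neq0.
Qed.

Lemma mult0 : mult set0 = 0%N.
Proof. by rewrite /Defs.mult match_poly0 // mupNroot // root1. Qed.

Lemma mult_components S : mult S = (\sum_(C in components e S) mult C)%N.
Proof.
have /and3P[/eqP covS tS _] := components_partition e_sym S.
(* Generalised to unions of subfamilies of components, so that they can be peeled off one at a
   time. *)
suff H n (Q : {set {set T}}) : (#|Q| <= n)%N -> Q \subset components e S ->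
    mult (cover Q) = (\sum_(C in Q) mult C)%N.
  by rewrite -[in LHS]covS (H _ _ (leqnn _)).
elim: n Q => [|n IHn] Q leQn sQ.
  by move: leQn; rewrite leqn0 cards_eq0 => /eqP->; rewrite /cover !big_set0 mult0.
have [->|[C CQ]] := set_0Vmem Q; first by rewrite /cover !big_set0 mult0.
have cov1 := coverD1 (trivIsetS sQ tS) CQ.
have sCQ : C \subset cover Q by apply: bigcup_sup.
rewrite (big_setD1 C CQ) -IHn; last first.
- exact: subset_trans (subD1set _ _) sQ.
- by have := cardsD1 C Q; rewrite CQ; lia.
rewrite cov1 -[in LHS](setID (cover Q) C) (setIidPr sCQ); apply: multU.
  by rewrite disjoint_sym disjoints_subset subsetDr.
move=> x y xC /setDP[/bigcupP[D DQ yD]]; apply: contra.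
apply: (component_closed (subsetP sQ _ CQ) xC).
exact: (subsetP (component_sub e_sym (subsetP sQ _ DQ))).
Qed.

Lemma ncritE S : ncrit e theta S = (\sum_(C in components e S) critical e theta C)%N.
Proof.
rewrite /ncrit -sum1_card (eq_bigl (fun C => (C \in components e S) && critical e theta C)).
  by rewrite big_mkcondr; apply: eq_bigr => C _; case: critical.
by move=> C; rewrite inE.
Qed.

Lemma critical_mult_gt0 C : critical e theta C -> (0 < mult C)%N.
Proof.
case/andP=> /imsetP[x xC _] /forall_inP/(_ x xC) /eqP <-; exact: ltn0Sn.
Qed.

Lemma ncrit_le_mult S : (ncrit e theta S <= mult S)%N.
Proof.
rewrite ncritE mult_components leq_sum // => C _.
by case: (boolP (critical _ _ _)) => // /critical_mult_gt0.
Qed.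

Lemma multD_le S X : X \subset S -> (mult (S :\: X) <= mult S + #|X|)%N.
Proof.
have [n] := ubnP #|X|; elim: n X => // n IHn X leXn sXS.
have [->|[u uX]] := set_0Vmem X; first by rewrite setD0 cards0 addn0.
have cX := cardsD1 u X; rewrite uX in cX.
have /IHn : (#|X :\ u| < n)%N by lia.
move=> /(_ (subset_trans (subD1set _ _) sXS)).
have := @multD1_le _ _ e_sym e_irr R theta (S :\: (X :\ u)) u.
rewrite setDDl setUC setD1K // !inE eqxx (subsetP sXS) //= => /(_ isT); lia.
Qed.

Lemma critical_mult1 C : critical e theta C -> mult C = 1%N.
Proof.
case/andP=> CC /forall_inP ess; have /imsetP[u uC _] := CC.
(* Parallelism to [u] spreads over [C] by adjacency and transitivity; [v == u] is the start of the
   propagation. *)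
have par : {in C, forall v, (v == u) || (mult C <= (mult (C :\ u :\ v)).+1)%N}.
  apply: (component_ind e_sym CC uC); first by rewrite eqxx.
  move=> v z vC zC /= par_v evz; have [//|zu] := eqVneq z u => /=.
  have [vu|vu] := eqVneq v u.
    by rewrite -vu essential_adjacent ?ess.
  rewrite (negPf vu) /= in par_v.
  apply: (essential_parallel_trans e_sym e_irr uC vC zC) => //; try exact: ess.
  - by rewrite eq_sym.
  - exact: edge_neq evz.
  - by rewrite eq_sym.
  by rewrite essential_adjacent ?ess.
(* An essential vertex [v] of [C :\ u] would bring the multiplicity down to [mult C - 2],
   contradicting [par]. *)
have /eqP <- := ess u uC; congr _.+1; apply/eqP; rewrite -leqn0 leqNgt.
apply/negP => /(essential_exists e_sym e_irr)[v]; rewrite !inE => /andP[vu vC].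
have := par v vC; rewrite (negPf vu) /essential /=; have /eqP := ess u uC; lia.
Qed.

(** A component of positive multiplicity has an essential vertex; without positive vertices,
    essentiality spreads to the whole component, which is then critical and contributes exactly
    1. *)
Lemma no_positive_mult S : {in S, forall u, mult (S :\ u) != (mult S).+1} ->
  mult S = ncrit e theta S.
Proof.
move=> npos; rewrite mult_components ncritE; apply: eq_bigr => C CS.
have [crit|ncrit] := boolP (critical e theta C); first exact: critical_mult1.
apply/eqP; rewrite -leqn0 leqNgt; apply: contra ncrit.
case/(essential_exists e_sym e_irr) => u uC essu.
have CC := component_self e_sym CS; rewrite /critical CC; apply/forall_inP.
apply: (component_ind e_sym CC uC essu) => x y xC yC essx exy.
apply: essential_neighbor (exy) essx _ => //.
have sCS := component_sub e_sym CS; have := npos y (subsetP sCS y yC).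
(* By additivity over [C] and [S :\: C], a vertex positive in [C] would be positive in [S]. *)
have noedge : {in C & S :\: C, forall x y, ~~ e x y}.
  by move=> a b aC /setDP[bS]; apply: contra; apply: component_closed CS aC bS.
have dC : [disjoint C & S :\: C] by rewrite disjoint_sym disjoints_subset subsetDr.
have -> : S :\ y = (C :\ y) :|: (S :\: C).
  apply/setP => a; rewrite !inE; have [->|ay] := eqVneq a y; first by rewrite yC.
  by case aC: (a \in C); rewrite //= (subsetP sCS).
rewrite -{2}(setID S C) (setIidPr sCS) !multU //; first by rewrite -addSn eqn_add2r.
  exact: disjointWl (subD1set _ _) dC.
by move=> a b /setD1P[_ aC]; exact: noedge.
Qed.

End Structure.

(** * Maximal Tutte sets and maximal extreme sets *)

Lemma tutte_extreme (T : finType) (e : rel T) (R : realFieldType) (theta : R)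
  (S X : {set T}) : symmetric e -> irreflexive e ->
  tutte_set e theta S X -> extreme_set e theta S X.
Proof.
move=> e_sym e_irr /andP[sXS /eqP tX]; rewrite /extreme_set sXS eqn_leq multD_le //=.
by rewrite -tX ncrit_le_mult.
Qed.

(** A positive vertex [u] of [S :\: X] could be added to [X] to give a larger extreme set. *)
Lemma maxset_extreme_tutte (T : finType) (e : rel T) (R : realFieldType) (theta : R)
  (S X : {set T}) : symmetric e -> irreflexive e ->
  maxset (fun Y : {set T} => extreme_set e theta S Y) X -> tutte_set e theta S X.
Proof.
move=> e_sym e_irr /maxsetP[/andP[sXS /eqP eX] maxX].
rewrite /tutte_set sXS -eX no_positive_mult //= => u /setDP[uS uX].
apply: contra (uX) => /eqP pos; rewrite -(maxX (u |: X)) ?setU11 ?subsetUr //.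
rewrite /extreme_set subUset sub1set uS sXS setUC -setDDl pos eX.
by rewrite setUC cardsU1 uX add1n addnS eqxx.
Qed.

Theorem theorem3p1 (T : finType) (e : rel T)
  (e_sym : symmetric e) (e_irr : irreflexive e)
  (R : realFieldType) (theta : R) (X : {set T}) :
  maxset (fun Y : {set T} => tutte_set e theta [set: T] Y) X <->
  maxset (fun Y : {set T} => extreme_set e theta [set: T] Y) X.
Proof.
split=> [maxX|maxX].
  have /maxsetP[tX mX] := maxX.
  (* A maximal extreme [Y] containing [X] is a Tutte set, so maximality of [X] gives [Y = X]. *)
  have [Y maxY sXY] := maxset_exists (P := fun Y => extreme_set e theta [set: T] Y)
    (tutte_extreme e_sym e_irr tX).
  by rewrite -(mX Y (maxset_extreme_tutte e_sym e_irr maxY) sXY).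
have /maxsetP[_ mX] := maxX; apply/maxsetP; split.
  exact: maxset_extreme_tutte maxX.
by move=> Y /(tutte_extreme e_sym e_irr); exact: mX.
Qed.
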